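(* Let $U\subset\mathcal{H}$ be an open set, let functions $f_i\colon U\to\mathbb{R}$, $i\in I=\{1,\dots,m\}$, be continuously codifferentiable on $U$, and let a real-valued function $G$ be defined and continuously differentiable on an open set $V\subset\mathbb{R}^m$ containing the set $\{f(x)\in\mathbb{R}^m\mid x\in U\}$, where $f(x)=(f_1(x),\dots,f_m(x))$. Then the function $g(\cdot)=G(f_1(\cdot),\dots,f_m(\cdot))$ is continuously codifferentiable on $U$, and for any $x\in U$ one can define $$Dg(x)=\sum_{i=1}^m\frac{\partial G}{\partial y_i}(f(x))\,Df_i(x).$$ Moreover, for any $r>0$ such that $B(x,r)\subset U$ and $\operatorname{co}f(B(x,r))\subset V$, and for all $\Delta x\in B(0,r)$, $\alpha\in(0,1]$, one has $$|\varepsilon_g(\alpha,\Delta x,x,r)|\le\sum_{i=1}^m\Big|\frac{\partial G}{\partial y_i}(f(x))\Big|\,|\varepsilon_{f_i}(\alpha,\Delta x,x,r)|+\frac1\alpha\sup_{t\in[0,1]}\Big|\big\langle\nabla G(y(t))-\nabla G(f(x)),\,f(x+\alpha\Delta x)-f(x)\big\rangle\Big|,$$ where $\langle\cdot,\cdot\rangle$ is the inner product in $\mathbb{R}^m$ and $y(t)=tf(x)+(1-t)f(x+\alpha\Delta x)$.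
   Context: $\mathcal{H}$ is a real Hilbert space with inner product $\langle\cdot,\cdot\rangle$, $B(y,r)=\{z\in\mathcal{H}\mid\|z-y\|\le r\}$. A function $f$ defined in a neighbourhood of $x$ is codifferentiable at $x$ if there exist (nonempty) weakly compact convex sets $\underline{d}f(x),\overline{d}f(x)\subset\mathbb{R}\times\mathcal{H}$ such that for any $\Delta x\in\mathcal{H}$ $$\lim_{\alpha\to+0}\frac1\alpha\Big|f(x+\alpha\Delta x)-f(x)-\max_{(a,v)\in\underline{d}f(x)}(a+\alpha\langle v,\Delta x\rangle)-\min_{(b,w)\in\overline{d}f(x)}(b+\alpha\langle w,\Delta x\rangle)\Big|=0$$ and $\max_{(a,v)\in\underline{d}f(x)}a+\min_{(b,w)\in\overline{d}f(x)}b=0$. The pair $Df(x)=[\underline{d}f(x),\overline{d}f(x)]$ is called a codifferential of $f$ at $x$ (it is not unique). Throughout, codifferentials are normalized: $\max_{(a,v)\in\underline{d}f(x)}a=\min_{(b,w)\in\overline{d}f(x)}b=0$. A function is continuously codifferentiable on $U$ if it is codifferentiable at every point of $U$ and there is a codifferential mapping $x\mapsto Df(x)$ such that $\underline{d}f(\cdot)$, $\overline{d}f(\cdot)$ are Hausdorff continuous on $U$; for continuously codifferentiable functions only such continuous codifferential mappings are considered. ''One can define $Dg(x)=\dots$'' means that the formula, built from the continuous codifferential mappings of the $f_i$, defines a continuous codifferential mapping. Operations on pairs of convex sets: $[A,B]+[C,D]=[A+C,B+D]$; $\lambda[A,B]=[\lambda A,\lambda B]$ if $\lambda\ge0$ and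 $\lambda[A,B]=[\lambda B,\lambda A]$ if $\lambda<0$. For $B(x,r)\subset U$, $\Delta x\in B(0,r)$, $\alpha\in(0,1]$, $$\varepsilon_f(\alpha,\Delta x,x,r)=\frac1\alpha\Big(f(x+\alpha\Delta x)-f(x)-\max_{(a,v)\in\underline{d}f(x)}(a+\alpha\langle v,\Delta x\rangle)-\min_{(b,w)\in\overline{d}f(x)}(b+\alpha\langle w,\Delta x\rangle)\Big)$$ for a real-valued codifferentiable function $f$, computed with the chosen codifferential (for $g$: the one given by the formula). *)

(* Defs.v *)
From HB Require Import structures.
From mathcomp Require Import all_boot all_order all_algebra.
From mathcomp Require Import all_classical all_reals all_analysis.

Set Implicit Arguments.
Unset Strict Implicit.
Unset Printing Implicit Defensive.

Import Order.TTheory GRing.Theory Num.Theory.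
Import numFieldNormedType.Exports.

Local Open Scope classical_set_scope.
Local Open Scope ring_scope.

(* [inner] is a symmetric positive definite bilinear form. *)
HB.mixin Record CompleteNormedModule_isHilbert (R : realType) H
    & CompleteNormedModule R H := {
  inner : {dot H for (@idfun R)} ;
  inner_normE : forall x : H, inner x x = `|x| ^+ 2
}.

#[short(type="hilbertType")]
HB.structure Definition Hilbert (R : realType) :=
  {H of CompleteNormedModule R H & CompleteNormedModule_isHilbert R H}.

Section WeakTopology.
Context {R : realType} (E : normedModType R).

(* The coarsest topology on [E] making every norm-continuous linear functional
   continuous. *)
Definition weakly : topologicalType :=
  sup_topology (fun phi : {phi : {linear E -> R^o} | continuous phi} =>
    Topological.on (initial_topology (sval phi))).

Definition weakly_compact (A : set E) : Prop := @compact weakly A.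

End WeakTopology.

Section SetOperations.
Context {R : realType} {E : normedModType R}.
Implicit Types (A B : set E) (P Q : set E * set E).

Definition set_addv A B : set E := [set a + b | a in A & b in B].

Definition set_scalev (l : R) A : set E := [set l *: a | a in A].

Definition setpair_add P Q : set E * set E :=
  (set_addv P.1 Q.1, set_addv P.2 Q.2).

Definition setpair_zero : set E * set E := ([set 0], [set 0]).

Definition setpair_scale (l : R) P : set E * set E :=
  if 0 <= l then (set_scalev l P.1, set_scalev l P.2)
  else (set_scalev l P.2, set_scalev l P.1).

Definition hausdorff_dist A B : \bar R :=
  maxe (ereal_sup [set ereal_inf [set `|a - b|%:E | b in B] | a in A])
       (ereal_sup [set ereal_inf [set `|a - b|%:E | a in A] | b in B]).

Definition hausdorff_continuous_at {T : topologicalType} (F : T -> set E)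
    (x : T) : Prop :=
  hausdorff_dist (F y) (F x) @[y --> x] --> 0%E.

Definition convex_hull A : set E := smallest (@convex_set R E) A.

End SetOperations.

Section Codifferential.
Context {R : realType} {H : hilbertType R}.

(* [R^o * H] carries the library's max-norm; it is equivalent to the Hilbert
   norm, so weak compactness and Hausdorff continuity do not depend on the
   choice. *)
Definition codiff : Type := (set (R^o * H) * set (R^o * H))%type.

Definition cball (y : H) (r : R) : set H := [set z | `|z - y| <= r].

(* The suprema and infima below are taken over images of nonempty weakly compact
   sets by weakly continuous functions, so they are maxima and minima. *)
Definition upper_part (A : set (R^o * H)) (alpha : R) (dx : H) : R :=
  sup [set p.1 + alpha * inner p.2 dx | p in A].

Definition lower_part (B : set (R^o * H)) (alpha : R) (dx : H) : R :=
  inf [set p.1 + alpha * inner p.2 dx | p in B].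

Definition codiff_remainder (f : H -> R) (D : codiff) (alpha : R) (dx x : H) :
    R :=
  f (x + alpha *: dx) - f x - upper_part D.1 alpha dx - lower_part D.2 alpha dx.

Definition codiff_error (f : H -> R) (D : codiff) (alpha : R) (dx x : H) : R :=
  alpha^-1 * codiff_remainder f D alpha dx x.

Definition admissible_set (A : set (R^o * H)) : Prop :=
  [/\ A !=set0, weakly_compact A & convex_set A].

Definition is_codifferential (f : H -> R) (x : H) (D : codiff) : Prop :=
  [/\ admissible_set D.1, admissible_set D.2,
      forall dx : H,
        (alpha^-1 * `|codiff_remainder f D alpha dx x|) @[alpha --> 0^'+] --> 0
    & sup [set p.1 | p in D.1] + inf [set p.1 | p in D.2] = 0 :> R].

Definition normalized (D : codiff) : Prop :=
  sup [set p.1 | p in D.1] = 0 :> R /\ inf [set p.1 | p in D.2] = 0 :> R.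

(* Functions on an open set [U] are represented by total functions whose values
   off [U] are irrelevant. *)
Definition continuous_codifferential (U : set H) (f : H -> R)
    (Df : H -> codiff) : Prop :=
  forall x, U x ->
    [/\ is_codifferential f x (Df x), normalized (Df x),
        hausdorff_continuous_at (fun y => (Df y).1) x
      & hausdorff_continuous_at (fun y => (Df y).2) x].

Definition continuously_codifferentiable (U : set H) (f : H -> R) : Prop :=
  exists Df : H -> codiff, continuous_codifferential U f Df.

End Codifferential.

Section EuclideanSpace.
Context {R : realType} {m : nat}.

Definition partial_derivative (G : 'rV[R]_m -> R) (i : 'I_m) (y : 'rV[R]_m) : R :=
  'D_(delta_mx 0 i) G y.

Definition gradient (G : 'rV[R]_m -> R) (y : 'rV[R]_m) : 'rV[R]_m :=
  \row_i partial_derivative G i y.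

Definition dotprod (u v : 'rV[R]_m) : R := \sum_(i < m) u 0 i * v 0 i.

Definition continuously_differentiable (V : set 'rV[R]_m)
    (G : 'rV[R]_m -> R) : Prop :=
  forall y, V y -> differentiable G y /\ {for y, continuous (gradient G)}.

Definition tuple_fun {T : Type} (f : 'I_m -> T -> R) (x : T) : 'rV[R]_m :=
  \row_i f i x.

End EuclideanSpace.

(* Main.v *)
Require Import Defs.
From HB Require Import structures.
From mathcomp Require Import all_boot all_order all_algebra.
From mathcomp Require Import all_classical all_reals all_analysis.
From mathcomp Require Import ring lra.

Set Implicit Arguments.
Unset Strict Implicit.
Unset Printing Implicit Defensive.

Import Order.TTheory GRing.Theory Num.Theory.
Import numFieldNormedType.Exports.

Local Open Scope classical_set_scope.
Local Open Scope ring_scope.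

(** The chain rule is linear calculus on pairs of convex sets, combined with the
    first-order expansion of [G].

    Write [F] for the tuple of the [f i], [c i] for the partial derivatives of
    [G] at [F x], and [F'] for [F (x + alpha *: d)].  Maxima and minima of a
    linear form are additive over sums of sets and are exchanged by negative
    scalars, so the maximum and the minimum attached to the pair
    [\sum_i c i * Df i x] add up to the combination, with coefficients [c i],
    of those of the [f i] ([chain_parts]).  This gives an exact identity
    ([chain_remainder]): the remainder of [g] is the first-order error
    [G F' - G (F x) - <grad G (F x), F' - F x>] plus the [c i]-combination of
    the remainders of the [f i].  Both conclusions are read off this identity.
    For the codifferential, the first-order error is [o(|F' - F x|)], and
    [F' - F x] is [O(alpha)] because normalized codifferentials of bounded size
    change the value by at most a multiple of [alpha]
    ([codifferential_increment_le]).  For the inequality, the mean value theorem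
    on the segment from [F'] to [F x] turns the first-order error into
    [<grad G (y t) - grad G (F x), F' - F x>] for some [t] ([chain_error_le]).

    Hausdorff continuity of the formula rests on two facts with some depth.
    Scaling by a varying coefficient is Hausdorff continuous only on
    norm-bounded sets; weakly compact sets are norm-bounded by the uniform
    boundedness principle ([weakly_compact_bounded]).  And the coefficients
    [c i] are continuous only if [F] is, although codifferentiability is a
    condition along rays: near each point the codifferentials have uniformly
    bounded size, so the functions have uniformly bounded one-sided slopes along
    every segment and are therefore locally Lipschitz
    ([codifferentiable_lipschitz]). *)

(** * Weak compactness *)

Section WeakCompactness.
Context {R : realType} {E : normedModType R}.
Implicit Types (A B : set E) (phi : {linear E -> R^o}).

Lemma weakly_continuous phi : continuous phi ->
  continuous (phi : weakly E -> R^o).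
Proof.
move=> cphi x.
pose i : {phi : {linear E -> R^o} | continuous phi} := exist _ phi cphi.
have : nbhs (x : weakly E) --> (x : initial_topology (sval i)).
  by have /cvg_sup/(_ i) : nbhs (x : weakly E) --> (x : weakly E) by exact.
move=> cx; apply: (cvg_trans _ (@initial_continuous _ _ (sval i) x)).
by move=> S /= hS; exact: cx.
Qed.

(** The universal property of the coarsest topology making the continuous linear
    functionals continuous. *)
Lemma continuous_weakly (T : topologicalType) (h : T -> weakly E) :
  (forall phi, continuous phi -> continuous (phi \o h : T -> R^o)) ->
  continuous h.
Proof.
move=> ch x; apply/cvg_sup => -[phi cphi] /=.
exact: (@continuous_comp_initial _ _ _ (phi : E -> R^o) h (ch _ cphi)).
Qed.

Lemma weakly_compact_set1 (a : E) : weakly_compact [set a].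
Proof. exact: compact_set1. Qed.

(** Addition is jointly continuous for the weak topology, as each functional
    carries it to addition in [R]; the sum is the image of the compact product. *)
Lemma weakly_compact_add A B :
  weakly_compact A -> weakly_compact B -> weakly_compact (set_addv A B).
Proof.
move=> cA cB; pose h (p : weakly E * weakly E) : weakly E := (p.1 : E) + p.2.
have ch : continuous h.
  apply: continuous_weakly => phi cphi p.
  rewrite (_ : _ \o _ = fun p : weakly E * weakly E => phi p.1 + phi p.2 : R^o).
    apply: cvgD; apply: continuous_comp;
      [exact: cvg_fst | exact: (weakly_continuous cphi) |
       exact: cvg_snd | exact: (weakly_continuous cphi)].
  by apply/funext => q /=; rewrite linearD.
have := continuous_compact (continuous_subspaceT ch) (compact_setX cA cB).
rewrite /weakly_compact; congr compact; apply/seteqP; split => z /=.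
  by move=> [[a b] [Aa Bb] <-]; exists a => //; exists b.
by move=> [a Aa [b Bb <-]]; exists (a, b).
Qed.

Lemma weakly_compact_scale (l : R) A :
  weakly_compact A -> weakly_compact (set_scalev l A).
Proof.
move=> cA; apply: (continuous_compact _ cA); apply: continuous_subspaceT.
apply: continuous_weakly => phi cphi p.
rewrite (_ : _ \o _ = ( *:%R l : R^o -> R^o) \o (phi : weakly E -> R^o)).
  apply: continuous_comp; first exact: (weakly_continuous cphi).
  exact: (@scaler_continuous R R^o l).
by apply/funext => q /=; rewrite linearZ.
Qed.

Lemma weakly_compact_bounded_image A phi : continuous phi ->
  weakly_compact A -> exists M, forall a, A a -> `|phi a| <= M.
Proof.
move=> cphi cA.
have := continuous_compact (continuous_subspaceT (weakly_continuous cphi)) cA.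
move=> /compact_bounded[M [_ MA]]; exists (M + 1) => a Aa.
by apply: (MA (M + 1)); [rewrite ltrDl | exists a].
Qed.

End WeakCompactness.

(** * Weakly compact subsets of [R * H] are norm-bounded *)

Section HilbertForms.
Context {R : realType} {H : hilbertType R}.
Implicit Types (u v w d : H) (p q : R^o * H) (A : set (R^o * H)).

Lemma innerC u v : inner u v = inner v u.
Proof. by rewrite (@hermitian_subproof _ _ _ _ inner) expr0 mul1r. Qed.

Lemma innerDl u v w : inner (u + v) w = inner u w + inner v w.
Proof. exact: linearDl. Qed.

Lemma innerZl (l : R) u v : inner (l *: u) v = l * inner u v.
Proof. exact: (linearZl_LR inner). Qed.

Lemma innerDr u v w : inner w (u + v) = inner w u + inner w v.
Proof. by rewrite innerC innerDl !(innerC w). Qed.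

Lemma innerZr (l : R) u v : inner u (l *: v) = l * inner u v.
Proof. by rewrite innerC innerZl innerC. Qed.

(** Cauchy-Schwarz, from the square of the norm of the component of [u]
    orthogonal to [v]. *)
Lemma inner_le u v : `|inner u v| <= `|u| * `|v|.
Proof.
have [->|v0] := eqVneq v 0.
  rewrite -(scale0r (0 : H)) innerZr mul0r scale0r !normr0 mulr0; exact: lexx.
have nv0 : 0 < `|v| ^+ 2 by rewrite exprn_gt0// normr_gt0.
pose t := inner u v / `|v| ^+ 2.
have : 0 <= inner (u + (- t) *: v) (u + (- t) *: v).
  by rewrite inner_normE exprn_ge0.
rewrite !(innerDl, innerDr, innerZl, innerZr) !inner_normE (innerC v u).
move=> h; have : 0 <= `|u| ^+ 2 - inner u v ^+ 2 / `|v| ^+ 2.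
  rewrite (le_trans h)// le_eqVlt; apply/orP; left; apply/eqP.
  by rewrite /t; field; rewrite normr_eq0.
rewrite subr_ge0 ler_pdivrMr// -exprMn -(real_normK (num_real (inner u v))).
by rewrite ler_pXn2r// nnegrE ?normr_ge0// mulr_ge0.
Qed.

(** The expressions maximized and minimized in a codifferential, seen as linear
    forms on [R * H]; at [alpha = 0] the form is the first projection. *)
Definition codiff_form (alpha : R) d p : R^o := p.1 + alpha * inner p.2 d.

Fact codiff_form_is_linear (alpha : R) d : linear (codiff_form alpha d).
Proof.
move=> l p q; rewrite /codiff_form/= innerDl innerZl /GRing.scale/=.
by ring.
Qed.

HB.instance Definition _ (alpha : R) d :=
  GRing.isLinear.Build R (R^o * H)%type R^o _ (codiff_form alpha d)
    (codiff_form_is_linear alpha d).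

Lemma codiff_form_le (alpha : R) d p :
  `|codiff_form alpha d p| <= (1 + `|alpha| * `|d|) * `|p|.
Proof.
have p1 : `|p.1| <= `|p| by rewrite prod_normE le_max lexx.
have p2 : `|p.2| <= `|p| by rewrite prod_normE le_max lexx orbT.
rewrite mulrDl mul1r (le_trans (ler_normD _ _))//; apply: lerD => //.
rewrite normrM -mulrA; apply: ler_wpM2l => //.
by rewrite (le_trans (inner_le _ _))// mulrC; apply: ler_wpM2l.
Qed.

Lemma codiff_form_continuous (alpha : R) d : continuous (codiff_form alpha d).
Proof.
apply/linear_bounded_continuous/linear_boundedP; near=> r => p.
apply: le_trans (codiff_form_le _ _ _) _; apply: ler_wpM2r => //.
Unshelve. end_near. Qed.

(** Each linear form is bounded on [A]. Hence so are the first components, and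
    the functionals [inner p.2] for [p] in [A] are pointwise bounded on the
    complete space [H]; by Banach-Steinhaus they are uniformly bounded on the
    unit ball, and [inner p.2] attains [|p.2|] at the normalized [p.2]. *)
Lemma weakly_compact_bounded A :
  weakly_compact A -> exists2 M, 0 <= M & forall p, A p -> `|p| <= M.
Proof.
move=> cA.
have form_bnd alpha d : exists M, forall p, A p -> `|codiff_form alpha d p| <= M.
  exact: weakly_compact_bounded_image (@codiff_form_continuous alpha d) cA.
have fst_bnd : exists M, forall p, A p -> `|p.1| <= M.
  have [M AM] := form_bnd 0 0; exists M => p /AM.
  by rewrite /codiff_form mul0r addr0.
have [M0 AM0] := fst_bnd.
pose Fam : set (H -> R^o) := [set inner p.2 | p in A].
have bFam : uniform_bounded Fam.
  apply: Banach_Steinhauss => [_ [p Ap <-]|d].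
    split=> [r|l u v]; last by rewrite innerDr innerZr.
    exists (`|p.2| * r) => x xr.
    by rewrite (le_trans (inner_le _ _))// ler_wpM2l.
  have [M1 AM1] := form_bnd 1 d.
  exists (M1 + M0) => _ [p Ap <-].
  rewrite (_ : inner p.2 d = codiff_form 1 d p - p.1).
    by rewrite (le_trans (ler_normB _ _))// lerD// ?AM1 ?AM0.
  by rewrite /codiff_form; ring.
have [M1 FM1] := bFam 1.
exists (`|M0| + `|M1|); first by rewrite addr_ge0.
move=> p Ap; rewrite prod_normE ge_max; apply/andP; split.
  by rewrite (le_trans (AM0 _ Ap))// (le_trans (ler_norm _))// lerDl.
have [->|v0] := eqVneq p.2 0; first by rewrite normr0 addr_ge0.
have nv : 0 < `|p.2| by rewrite normr_gt0.
have : `|inner p.2 (`|p.2|^-1 *: p.2)| <= M1.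
  apply: FM1; first by exists p.
  by rewrite normrZ normfV normr_id mulVf ?gt_eqF.
rewrite innerZr inner_normE expr2 mulKf ?gt_eqF// normr_id => /le_trans -> //.
by rewrite (le_trans (ler_norm _))// lerDr.
Qed.

End HilbertForms.

(** * Hausdorff continuity of sums and multiples of sets *)

Section HausdorffContinuity.
Context {R : realType} {E : normedModType R} {T : topologicalType}.
Implicit Types (A B : set E) (F G : T -> set E).

(** A condition between [hausdorff_dist A B < e] and [hausdorff_dist A B <= e]
    that involves only points, so that estimates can be made in [R]. *)
Definition hausdorff_close (e : R) A B : Prop :=
  (forall a, A a -> exists2 b, B b & `|a - b| <= e) /\
  (forall b, B b -> exists2 a, A a & `|a - b| <= e).

Lemma hausdorff_dist_le (e : R) A B :
  hausdorff_close e A B -> (hausdorff_dist A B <= e%:E)%E.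
Proof.
move=> [AB BA]; rewrite /hausdorff_dist ge_max; apply/andP; split.
  apply: ge_ereal_sup => _ [a Aa <-]; have [b Bb ab] := AB _ Aa.
  apply: (@le_trans _ _ `|a - b|%:E); last by rewrite lee_fin.
  by apply: ereal_inf_lbound; exists b.
apply: ge_ereal_sup => _ [b Bb <-]; have [a Aa ab] := BA _ Bb.
apply: (@le_trans _ _ `|a - b|%:E); last by rewrite lee_fin.
by apply: ereal_inf_lbound; exists a.
Qed.

Lemma hausdorff_dist_lt (e : R) A B :
  (hausdorff_dist A B < e%:E)%E -> hausdorff_close e A B.
Proof.
rewrite /hausdorff_dist gt_max => /andP[ltA ltB]; split=> [a Aa|b Bb].
  have : (ereal_inf [set `|a - b|%:E | b in B] < e%:E)%E.
    by apply: le_lt_trans ltA; apply: ereal_sup_ubound; exists a.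
  by move=> /ereal_inf_lt[_ [b Bb <-]]; rewrite lte_fin => /ltW; exists b.
have : (ereal_inf [set `|a - b|%:E | a in A] < e%:E)%E.
  by apply: le_lt_trans ltB; apply: ereal_sup_ubound; exists b.
by move=> /ereal_inf_lt[_ [a Aa <-]]; rewrite lte_fin => /ltW; exists a.
Qed.

Lemma hausdorff_dist_ge0 A B : B !=set0 -> (0 <= hausdorff_dist A B)%E.
Proof.
move=> [b Bb]; rewrite /hausdorff_dist le_max; apply/orP; right.
apply: (@le_trans _ _ (ereal_inf [set `|a - b|%:E | a in A])).
  by apply: le_ereal_inf_tmp => _ [a _ <-]; rewrite lee_fin.
by apply: ereal_sup_ubound; exists b.
Qed.

(** Nonemptiness of [F x] matters: the supremum of the empty set is [-oo], so the
    distance between two empty sets is not [0]. *)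
Lemma hausdorff_continuousP F x : F x !=set0 ->
  hausdorff_continuous_at F x <->
  forall e, 0 < e -> \forall y \near x, hausdorff_close e (F y) (F x).
Proof.
move=> Fx0; split=> [cF e e0|cF].
  have : nbhs (0%E : \bar R) [set z | (z < e%:E)%E].
    have : nbhs (0 : R) [set r | r < e] by exact: lt_nbhsl.
    exact.
  move=> /cF dFe; near=> y; apply: hausdorff_dist_lt.
  by near: y; exact: dFe.
move=> A /= A0; have /nbhs_ballP[e /= e0 eA] : nbhs (0 : R) (fun r => A r%:E).
  exact: A0.
have e20 : 0 < e / 2 by rewrite divr_gt0.
apply: filterS (cF _ e20) => y /hausdorff_dist_le.
rewrite -[X in _ -> X]/(A (hausdorff_dist (F y) (F x))).
have := hausdorff_dist_ge0 (F y) Fx0.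
case: hausdorff_dist => [r| |]; rewrite ?lee_fin// ?leey_eq ?lee_ninfty_eq//.
move=> r0 re; apply: (eA r); rewrite /ball/= sub0r normrN ger0_norm//.
by rewrite (le_lt_trans re)// ltr_pdivrMr// ltr_pMr// ltr1n.
Unshelve. all: by end_near. Qed.

Lemma hausdorff_continuous_add F G x : F x !=set0 -> G x !=set0 ->
  hausdorff_continuous_at F x -> hausdorff_continuous_at G x ->
  hausdorff_continuous_at (fun y => set_addv (F y) (G y)) x.
Proof.
move=> Fx0 Gx0 /(hausdorff_continuousP Fx0) cF /(hausdorff_continuousP Gx0) cG.
have FGx0 : set_addv (F x) (G x) !=set0.
  by have [a ?] := Fx0; have [b ?] := Gx0; exists (a + b); exists a => //; exists b.
apply/(hausdorff_continuousP FGx0) => e e0.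
have e20 : 0 < e / 2 by rewrite divr_gt0.
near=> y.
have [FF' FF''] : hausdorff_close (e / 2) (F y) (F x) by near: y; exact: cF.
have [GG' GG''] : hausdorff_close (e / 2) (G y) (G x) by near: y; exact: cG.
have tri (a b c d : E) : `|a - b| <= e / 2 -> `|c - d| <= e / 2 ->
    `|a + c - (b + d)| <= e.
  move=> ab cd; rewrite opprD addrACA (splitr e).
  by rewrite (le_trans (ler_normD _ _))// lerD.
split=> _ [a Aa [b Bb <-]].
  have [a' Aa' aa'] := FF' _ Aa; have [b' Bb' bb'] := GG' _ Bb.
  by exists (a' + b'); [exists a' => //; exists b' | exact: tri].
have [a' Aa' aa'] := FF'' _ Aa; have [b' Bb' bb'] := GG'' _ Bb.
by exists (a' + b'); [exists a' => //; exists b' | exact: tri].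
Unshelve. all: by end_near. Qed.

(** From [c y *: a - c x *: b = c y *: (a - b) + (c y - c x) *: b]: the first term
    is controlled by the distance of the sets, the second by the bound [M]. *)
Lemma hausdorff_continuous_scale (c : T -> R) F (M : R) x : F x !=set0 ->
  (forall a, F x a -> `|a| <= M) ->
  {for x, continuous c} -> hausdorff_continuous_at F x ->
  hausdorff_continuous_at (fun y => set_scalev (c y) (F y)) x.
Proof.
move=> Fx0 FM cc /(hausdorff_continuousP Fx0) cF.
have cFx0 : set_scalev (c x) (F x) !=set0.
  by have [a ?] := Fx0; exists (c x *: a); exists a.
have M0 : 0 <= M by have [a /FM] := Fx0; exact: le_trans.
apply/(hausdorff_continuousP cFx0) => e e0.
pose K := `|c x| + 1; have K0 : 0 < K by rewrite ltr_wpDl.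
have M10 : 0 < M + 1 by rewrite ltr_wpDl.
near=> y.
have [FF' FF''] : hausdorff_close (e / 2 / K) (F y) (F x).
  by near: y; apply: cF; rewrite !divr_gt0.
have cyx : `|c y - c x| <= e / 2 / (M + 1).
  rewrite distrC; near: y.
  by apply: (cvgr_dist_le _ _ cc); rewrite !divr_gt0.
have cyK : `|c y| <= K.
  have : `|c y - c x| <= 1.
    rewrite distrC; near: y.
    by apply: (cvgr_dist_le _ _ cc).
  move=> h; rewrite -(subrK (c x) (c y)) (le_trans (ler_normD _ _))//.
  by rewrite addrC lerD2l.
have tri (a b : E) : F x b -> `|a - b| <= e / 2 / K ->
    `|c y *: a - c x *: b| <= e.
  move=> Fb ab.
  have -> : c y *: a - c x *: b = c y *: (a - b) + (c y - c x) *: b.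
    by rewrite scalerBr scalerBl addrA subrK.
  rewrite (le_trans (ler_normD _ _))// !normrZ (splitr e) lerD//.
    rewrite (le_trans (ler_pM _ _ cyK ab))//.
    by rewrite mulrC divfK// gt_eqF.
  rewrite (le_trans (ler_pM _ _ cyx (FM _ Fb)))//.
  rewrite mulrAC ler_pdivrMr// ler_pM2l ?divr_gt0//.
  by rewrite lerDl.
split=> _ [a Aa <-].
  have [b Bb ab] := FF' _ Aa.
  by exists (c x *: b); [exists b | exact: tri].
have [b Bb ab] := FF'' _ Aa.
by exists (c y *: b); [exists b | exact: tri].
Unshelve. all: by end_near. Qed.

End HausdorffContinuity.

(** * Maxima and minima of linear forms on admissible sets *)

Section ScaledSuprema.
Context {R : realType}.
Implicit Types (S : set R) (l : R).

Lemma sup_ge0_scale l S : has_sup S -> 0 <= l ->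
  sup [set l * s | s in S] = l * sup S.
Proof.
move=> supS; have [S0 ubS] := supS; rewrite le_eqVlt => /predU1P[<-|l0].
  rewrite mul0r (_ : [set _ | _ in _] = [set 0]) ?sup1//.
  have [s Ss] := S0; apply/seteqP; split=> [_ [t _ <-]|_ ->]; rewrite ?mul0r//.
  by exists s; rewrite ?mul0r.
have lS_ub : ubound [set l * s | s in S] (l * sup S).
  by move=> _ [s Ss <-]; rewrite ler_pM2l//; exact: ub_le_sup.
have lS0 : [set l * s | s in S] !=set0.
  by have [s Ss] := S0; exists (l * s); exists s.
apply/eqP; rewrite eq_le; apply/andP; split; first exact: ge_sup.
rewrite -ler_pdivlMl//; apply: ge_sup => // s Ss; rewrite ler_pdivlMl//.
by apply: ub_le_sup; [exists (l * sup S) | exists s].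
Qed.

Lemma inf_ge0_scale l S : has_inf S -> 0 <= l ->
  inf [set l * s | s in S] = l * inf S.
Proof.
move=> /has_inf_supN infS l0; rewrite /inf mulrN -(sup_ge0_scale infS l0).
by congr (- sup _); rewrite !image_comp; apply: eq_imagel => s _ /=; rewrite mulrN.
Qed.

Lemma sup_le0_scale l S : has_inf S -> l <= 0 ->
  sup [set l * s | s in S] = l * inf S.
Proof.
move=> /has_inf_supN infS l0.
rewrite /inf mulrN -mulNr -(sup_ge0_scale infS) ?oppr_ge0//.
by congr sup; rewrite !image_comp; apply: eq_imagel => s _ /=; rewrite mulrNN.
Qed.

Lemma inf_le0_scale l S : has_sup S -> l <= 0 ->
  inf [set l * s | s in S] = l * sup S.
Proof.
move=> supS l0; rewrite /inf -[RHS]opprK -mulNr -(sup_ge0_scale supS) ?oppr_ge0//.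
by congr (- sup _); rewrite image_comp; apply: eq_imagel => s _ /=; rewrite mulNr.
Qed.

End ScaledSuprema.

Section AdmissibleSets.
Context {R : realType} {H : hilbertType R}.
Implicit Types (A B : set (R^o * H)) (D : @codiff R H) (l alpha : R) (d : H).

Lemma admissible_set0 : admissible_set [set (0 : R^o * H)].
Proof.
split; [by exists 0 | exact: weakly_compact_set1 |].
by move=> p q k; rewrite !inE => -> ->; rewrite /conv/= !scaler0 addr0.
Qed.

Lemma admissible_set_add A B :
  admissible_set A -> admissible_set B -> admissible_set (set_addv A B).
Proof.
move=> [[a Aa] cA kA] [[b Bb] cB kB]; split.
- by exists (a + b); exists a => //; exists b.
- exact: weakly_compact_add.
move=> p q k; rewrite !inE => -[a1 Aa1 [b1 Bb1 <-]] [a2 Aa2 [b2 Bb2 <-]].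
have := kA a1 a2 k; rewrite !inE => /(_ Aa1 Aa2) Aa12.
have := kB b1 b2 k; rewrite !inE => /(_ Bb1 Bb2) Bb12.
exists (conv k (a1 : convex_lmodType _) a2) => //.
exists (conv k (b1 : convex_lmodType _) b2) => //.
by rewrite /conv/= !scalerDr addrACA.
Qed.

Lemma admissible_set_scale l A :
  admissible_set A -> admissible_set (set_scalev l A).
Proof.
move=> [[a Aa] cA kA]; split.
- by exists (l *: a); exists a.
- exact: weakly_compact_scale.
move=> p q k; rewrite !inE => -[a1 Aa1 <-] [a2 Aa2 <-].
have := kA a1 a2 k; rewrite !inE => /(_ Aa1 Aa2) Aa12.
exists (conv k (a1 : convex_lmodType _) a2) => //.
by rewrite /conv/= scalerDr !scalerA !(mulrC l).
Qed.

Lemma admissible_has_sup_inf A alpha d : admissible_set A ->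
  has_sup (codiff_form alpha d @` A) /\ has_inf (codiff_form alpha d @` A).
Proof.
move=> [[a Aa] cA _].
have [M AM] := weakly_compact_bounded_image (@codiff_form_continuous _ _ alpha d) cA.
split; (split; first by exists (codiff_form alpha d a); exists a).
  by exists M => _ [p Ap <-]; rewrite (le_trans (ler_norm _))// AM.
exists (- M) => _ [p Ap <-].
by rewrite lerNl (le_trans (ler_norm _))// normrN AM.
Qed.

Lemma image_codiff_form_add alpha d A B :
  codiff_form alpha d @` set_addv A B =
  [set s + t | s in codiff_form alpha d @` A & t in codiff_form alpha d @` B].
Proof.
apply/seteqP; split=> [_ [_ [a Aa [b Bb <-]] <-]|_ [_ [a Aa <-] [_ [b Bb <-] <-]]].
  exists (codiff_form alpha d a); first by exists a.
  by exists (codiff_form alpha d b); [exists b | rewrite linearD].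
by exists (a + b); [exists a => //; exists b | rewrite linearD].
Qed.

Lemma image_codiff_form_scale alpha d l A :
  codiff_form alpha d @` set_scalev l A =
  [set l * s | s in codiff_form alpha d @` A].
Proof.
by rewrite !image_comp; apply: eq_imagel => p _ /=; rewrite linearZ.
Qed.

Lemma upper_part_add A B alpha d : admissible_set A -> admissible_set B ->
  upper_part (set_addv A B) alpha d = upper_part A alpha d + upper_part B alpha d.
Proof.
move=> /(admissible_has_sup_inf alpha d)[sA _] /(admissible_has_sup_inf alpha d)[sB _].
by rewrite -(sup_sumE sA sB) -image_codiff_form_add.
Qed.

Lemma lower_part_add A B alpha d : admissible_set A -> admissible_set B ->
  lower_part (set_addv A B) alpha d = lower_part A alpha d + lower_part B alpha d.
Proof.
move=> /(admissible_has_sup_inf alpha d)[_ iA] /(admissible_has_sup_inf alpha d)[_ iB].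
by rewrite -(inf_sumE iA iB) -image_codiff_form_add.
Qed.

Definition admissible_pair D := admissible_set D.1 /\ admissible_set D.2.

Lemma setpair_scale_parts l D alpha d : admissible_pair D ->
  upper_part (setpair_scale l D).1 alpha d =
    (if 0 <= l then l * upper_part D.1 alpha d else l * lower_part D.2 alpha d) /\
  lower_part (setpair_scale l D).2 alpha d =
    (if 0 <= l then l * lower_part D.2 alpha d else l * upper_part D.1 alpha d).
Proof.
move=> [/(admissible_has_sup_inf alpha d)[s1 i1]].
move=> /(admissible_has_sup_inf alpha d)[s2 i2].
have scaleE A (l' : R) : [set p.1 + alpha * inner p.2 d | p in set_scalev l' A] =
    [set l' * s | s in codiff_form alpha d @` A] by exact: image_codiff_form_scale.
rewrite /setpair_scale /upper_part /lower_part; case: ifPn => l0 /=.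
  by rewrite !scaleE sup_ge0_scale// inf_ge0_scale.
have {}l0 : l <= 0 by rewrite ltW// ltNge.
by rewrite !scaleE sup_le0_scale// inf_le0_scale.
Qed.

Lemma upper_part0 alpha d : upper_part [set (0 : R^o * H)] alpha d = 0.
Proof. by rewrite /upper_part image_set1 sup1 -[LHS]/(codiff_form alpha d 0) linear0. Qed.

Lemma lower_part0 alpha d : lower_part [set (0 : R^o * H)] alpha d = 0.
Proof. by rewrite /lower_part image_set1 inf1 -[LHS]/(codiff_form alpha d 0) linear0. Qed.

Lemma upper_part_alpha0 A d : upper_part A 0 d = sup [set p.1 | p in A].
Proof. by congr sup; apply: eq_imagel => p _; rewrite mul0r addr0. Qed.

Lemma lower_part_alpha0 A d : lower_part A 0 d = inf [set p.1 | p in A].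
Proof. by congr inf; apply: eq_imagel => p _; rewrite mul0r addr0. Qed.

End AdmissibleSets.

(** * Continuity of continuously codifferentiable functions *)

(** Let [c] be the supremum of the [t] with [|phi t - phi 0| <= K * t]. The
    condition at [c] shows that [c] is such a [t], and that [c] can be pushed to
    the right unless [c = 1]. *)
Lemma pointwise_lipschitz_le (R : realType) (phi : R -> R) (K : R) :
  (forall t, 0 <= t <= 1 -> exists2 delta, 0 < delta &
     forall s, `|s - t| < delta -> `|phi s - phi t| <= K * `|s - t|) ->
  `|phi 1 - phi 0| <= K.
Proof.
move=> lip.
pose S := [set t | 0 <= t <= 1 /\ `|phi t - phi 0| <= K * t].
have S0 : S 0 by split; rewrite ?lexx ?ler01// subrr normr0 mulr0.
have S1 : ubound S 1 by move=> t [/andP[]].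
have supS : has_sup S by split; [exists 0 | exists 1].
pose c := sup S.
have c01 : 0 <= c <= 1.
  by apply/andP; split; [exact: ub_le_sup supS.2 _ S0 | apply: ge_sup S1; exists 0].
have [delta d0 lipc] := lip c c01.
have Sc : S c.
  split=> //; have [t [t01 tK] ct] := sup_adherent d0 supS.
  have tc : t <= c by apply: ub_le_sup supS.2 _ _.
  have := lipc t; rewrite distrC ger0_norm ?subr_ge0// => /(_ _)/wrap[].
    by rewrite ltrBlDr -ltrBlDl.
  rewrite distrC => phict; rewrite -(subrKA (phi t)) (le_trans (ler_normD _ _))//.
  by rewrite -[leRHS](subrK (K * t)) -mulrBr lerD.
pose c' := Num.min 1 (c + delta / 2).
have cc' : c <= c'.
  by rewrite le_min (andP c01).2 lerDl divr_ge0 ?ltW.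
have Sc' : S c'.
  split; first by rewrite ge_min lexx (le_trans (andP c01).1).
  have := lipc c'; rewrite ger0_norm ?subr_ge0// => /(_ _)/wrap[].
    rewrite ltrBlDl gt_min; apply/orP; right.
    by rewrite ltrD2l ltr_pdivrMr// ltr_pMr// ltr1n.
  move=> phicc'; rewrite -(subrKA (phi c)) (le_trans (ler_normD _ _))//.
  by rewrite -[leRHS](subrK (K * c)) -mulrBr lerD// Sc.2.
have : c' <= c by exact: ub_le_sup supS.2 _ Sc'.
rewrite ge_min => /orP[c1|]; last by rewrite gerDl leNgt divr_gt0.
have {c1}c1 : c = 1 by apply/eqP; rewrite eq_le (andP c01).2.
by have := Sc.2; rewrite c1 mulr1.
Qed.

Section LocalLipschitz.
Context {R : realType} {H : hilbertType R}.
Implicit Types (A B : set (R^o * H)) (D : @codiff R H) (M alpha : R) (d x z : H).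
Implicit Types (f : H -> R).

(** The form at [alpha] differs from the first projection by
    [alpha * inner p.2 d], and taking suprema does not increase uniform
    distances. *)
Lemma upper_part_dist A M alpha d : admissible_set A ->
  (forall p, A p -> `|p| <= M) ->
  `|upper_part A alpha d - sup [set p.1 | p in A]| <= `|alpha| * (M * `|d|).
Proof.
move=> adA AM; rewrite -(upper_part_alpha0 A d).
have form_dist p : A p ->
    `|codiff_form alpha d p - codiff_form 0 d p| <= `|alpha| * (M * `|d|).
  move=> Ap; rewrite /codiff_form mul0r addr0 addrC addKr normrM ler_wpM2l//.
  rewrite (le_trans (inner_le _ _))// ler_wpM2r// (le_trans _ (AM _ Ap))//.
  by rewrite prod_normE le_max lexx orbT.
have [[nA uA] _] := admissible_has_sup_inf alpha d adA.
have [[nA0 uA0] _] := admissible_has_sup_inf 0 d adA.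
rewrite ler_distl; apply/andP; split.
  rewrite lerBlDr; apply: ge_sup => // _ [p Ap <-].
  rewrite -lerBlDr (@le_trans _ _ (codiff_form alpha d p))//.
    have := form_dist _ Ap; rewrite ler_distl => /andP[].
    by rewrite /codiff_form; lra.
  by apply: ub_le_sup => //; exists p.
apply: ge_sup => // _ [p Ap <-].
rewrite -lerBlDr (@le_trans _ _ (codiff_form 0 d p))//.
  have := form_dist _ Ap; rewrite ler_distl => /andP[].
  by rewrite /codiff_form; lra.
by apply: ub_le_sup => //; exists p.
Qed.

Lemma lower_part_dist B M alpha d : admissible_set B ->
  (forall p, B p -> `|p| <= M) ->
  `|lower_part B alpha d - inf [set p.1 | p in B]| <= `|alpha| * (M * `|d|).
Proof.
move=> adB BM; have adN := admissible_set_scale (-1) adB.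
have NM p : set_scalev (-1) B p -> `|p| <= M.
  by move=> [q Bq <-]; rewrite scaleN1r normrN BM.
have := upper_part_dist alpha d adN NM.
rewrite -(upper_part_alpha0 _ d) -(lower_part_alpha0 _ d).
have lt0N : (0 <= -1 :> R) = false by rewrite ler0N1.
have UN a : upper_part (set_scalev (-1) B) a d = - lower_part B a d.
  have [] := @setpair_scale_parts R H (-1) (B, B) a d (conj adB adB).
  by rewrite /setpair_scale lt0N /= mulN1r.
by rewrite !UN opprK [- _ + _]addrC distrC.
Qed.

(** Normalization makes both extrema vanish at [alpha = 0], so by the preceding
    bounds each is [O(alpha)]; the remainder is [o(alpha)]. *)
Lemma codifferential_increment_le f z D M d (e : R) :
  is_codifferential f z D -> normalized D ->
  (forall p, D.1 p -> `|p| <= M) -> (forall p, D.2 p -> `|p| <= M) -> 0 < e ->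
  \forall alpha \near 0^'+,
    `|f (z + alpha *: d) - f z| <= (2 * (M * `|d|) + e) * alpha.
Proof.
move=> [ad1 ad2 /(_ d) lim0 _] [sup0 inf0] M1 M2 e0.
have := cvgr0_norm_le _ lim0 _ e0 => rem_le.
near=> alpha.
have a0 : 0 < alpha by near: alpha; exact: nbhs_right_gt.
have : `|alpha^-1 * `|codiff_remainder f D alpha d z| | <= e.
  by near: alpha; exact: rem_le.
rewrite normrM normr_id (ger0_norm (x := alpha^-1)) ?invr_ge0 ?(ltW a0)//.
rewrite ler_pdivrMl//.
have := upper_part_dist alpha d ad1 M1; have := lower_part_dist alpha d ad2 M2.
rewrite sup0 inf0 !subr0 (gtr0_norm a0) /codiff_remainder => hl hu hr.
rewrite (_ : f _ - f z = (f (z + alpha *: d) - f z -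
    upper_part D.1 alpha d - lower_part D.2 alpha d) +
    (upper_part D.1 alpha d + lower_part D.2 alpha d)); last by ring.
rewrite (le_trans (ler_normD _ _))// mulrDl addrC lerD//; last by rewrite mulrC.
rewrite (le_trans (ler_normD _ _))// (le_trans (lerD hu hl))//.
by rewrite le_eqVlt; apply/orP; left; apply/eqP; ring.
Unshelve. all: by end_near. Qed.

(** On the segment from [x] to [y], the increment bound in the directions
    [y - x] and [x - y] bounds the slopes of [f] on both sides of every point. *)
Lemma codifferentiable_lipschitz f (Df : H -> @codiff R H) M x (rho : R) :
  (forall z, `|z - x| < rho ->
     [/\ is_codifferential f z (Df z), normalized (Df z),
         forall p, (Df z).1 p -> `|p| <= M & forall p, (Df z).2 p -> `|p| <= M]) ->
  forall y, `|y - x| < rho -> `|f y - f x| <= 2 * (M * `|y - x|).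
Proof.
move=> Dfz y yx; apply/ler_addgt0Pr => e e0.
pose d := y - x; pose phi (t : R) := f (x + t *: d).
have -> : f y = phi 1 by rewrite /phi scale1r addrC subrK.
have -> : f x = phi 0 by rewrite /phi scale0r addr0.
apply: pointwise_lipschitz_le => t /andP[t0 t1].
pose z := x + t *: d.
have [cd nd M1 M2] : [/\ is_codifferential f z (Df z), normalized (Df z),
    forall p, (Df z).1 p -> `|p| <= M & forall p, (Df z).2 p -> `|p| <= M].
  apply: Dfz; rewrite /z addrC addKr normrZ ger0_norm//.
  by rewrite (le_lt_trans _ yx)// ler_piMl.
have /nbhs_ballP[d1 /= d10 near1] := codifferential_increment_le d cd nd M1 M2 e0.
have /nbhs_ballP[d2 /= d20 near2] := codifferential_increment_le (- d) cd nd M1 M2 e0.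
exists (Num.min d1 d2); first by rewrite lt_min d10.
move=> s; rewrite lt_min => /andP[sd1 sd2].
have [st|ts|->] := ltgtP s t; last by rewrite !subrr normr0 mulr0.
  have -> : phi s = f (z + `|s - t| *: (- d)).
    rewrite /phi /z distrC ger0_norm ?subr_ge0 ?ltW// scalerN -scaleNr opprB.
    by rewrite -addrA -scalerDl [t + _]addrC subrK.
  rewrite -[in leRHS](normrN d); apply: near2.
    by rewrite /ball/= sub0r normrN normr_id.
  by rewrite normr_gt0 subr_eq0 lt_eqF.
have -> : phi s = f (z + `|s - t| *: d).
  rewrite /phi /z ger0_norm ?subr_ge0 ?ltW//.
  by rewrite -addrA -scalerDl [t + _]addrC subrK.
apply: near1; first by rewrite /ball/= sub0r normrN normr_id.
by rewrite normr_gt0 subr_eq0 gt_eqF.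
Qed.

(** The sets near [x] lie within distance [1] of the bounded set [F x]. *)
Lemma hausdorff_continuous_bounded (F : H -> set (R^o * H)) x :
  admissible_set (F x) -> hausdorff_continuous_at F x ->
  exists M, \forall y \near x, forall p, F y p -> `|p| <= M.
Proof.
move=> [Fx0 cFx _] /(hausdorff_continuousP Fx0)/(_ _ ltr01) Fyx.
have [M M0 FM] := weakly_compact_bounded cFx.
exists (1 + M); apply: filterS Fyx => y [yx _] p /yx[q /FM qM pq].
by rewrite -(subrK q p) (le_trans (ler_normD _ _))// lerD.
Qed.

Lemma continuous_codifferential_continuous (U : set H) f (Df : H -> @codiff R H) x :
  open U -> continuous_codifferential U f Df -> U x -> {for x, continuous f}.
Proof.
move=> oU cDf Ux; have [[ad1 ad2 _ _] _ c1 c2] := cDf _ Ux.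
have [M1 b1] := hausdorff_continuous_bounded ad1 c1.
have [M2 b2] := hausdorff_continuous_bounded ad2 c2.
pose M := Num.max M1 M2.
have : \forall z \near x, [/\ is_codifferential f z (Df z), normalized (Df z),
    forall p, (Df z).1 p -> `|p| <= M & forall p, (Df z).2 p -> `|p| <= M].
  near=> z.
  have Uz : U z by near: z; exact: open_nbhs_nbhs.
  have [? ? _ _] := cDf _ Uz; split=> // p pz.
    rewrite le_max; apply/orP; left; move: p pz; near: z; exact: b1.
  rewrite le_max; apply/orP; right; move: p pz; near: z; exact: b2.
move=> /nbhs_normP[rho /= rho0 Dfz].
have lip y : `|y - x| < rho -> `|f y - f x| <= 2 * (M * `|y - x|).
  by apply: codifferentiable_lipschitz => z zx; apply: Dfz; rewrite /= distrC.
apply/cvgrPdist_le => e e0.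
have M0 : 0 < 2 * (`|M| + 1) by rewrite mulr_gt0// ltr_wpDl.
near=> y.
have yx : `|y - x| < rho.
  by rewrite distrC; near: y; exact: (@cvgr_dist_lt _ _ _ (nbhs x) _ id).
have yxe : `|y - x| <= e / (2 * (`|M| + 1)).
  rewrite distrC; near: y; apply: (@cvgr_dist_le _ _ _ (nbhs x) _ id) => //.
  by rewrite divr_gt0.
rewrite distrC (le_trans (lip _ yx))// mulrA.
rewrite (@le_trans _ _ (2 * (`|M| + 1) * `|y - x|))//.
  by rewrite ler_wpM2r// ler_pM2l// (le_trans (ler_norm _))// lerDl.
by rewrite mulrC -ler_pdivlMr.
Unshelve. all: by end_near. Qed.

End LocalLipschitz.

(** * First-order expansion along segments *)

Section Gradient.
Context {R : realType} {m : nat}.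
Implicit Types (G : 'rV[R]_m -> R) (u v w : 'rV[R]_m) (V : set 'rV[R]_m).

Lemma row_norm_le u (e : R) : 0 <= e -> (forall i, `|u 0 i| <= e) -> `|u| <= e.
Proof.
move=> e0 ue; rewrite /Num.norm/= mx_normrE; apply: bigmax_le => // -[i j] _ /=.
by rewrite ord1.
Qed.

Lemma dotprodDl u v w : dotprod (u + v) w = dotprod u w + dotprod v w.
Proof.
by rewrite /dotprod -big_split; apply: eq_bigr => i _; rewrite mxE mulrDl.
Qed.

Lemma dotprodNr u v : dotprod u (- v) = - dotprod u v.
Proof.
by rewrite /dotprod -sumrN; apply: eq_bigr => i _; rewrite mxE mulrN.
Qed.

Lemma dotprodNl u v : dotprod (- u) v = - dotprod u v.
Proof.
by rewrite /dotprod -sumrN; apply: eq_bigr => i _; rewrite mxE mulNr.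
Qed.

Lemma derive_dotprod G u v : differentiable G u ->
  'D_v G u = dotprod (gradient G u) v.
Proof.
move=> dG; rewrite (deriveE v dG) [in LHS](row_sum_delta v) linear_sum.
by apply: eq_bigr => i _; rewrite linearZ mxE /partial_derivative deriveE// mulrC.
Qed.

Lemma gradient_remainder_le G u (e : R) : differentiable G u -> 0 < e ->
  \forall w \near u, `|G w - G u - dotprod (gradient G u) (w - u)| <= e * `|w - u|.
Proof.
move=> dG e0; have /diff_locallyP[_ /eqaddoP/(_ e e0)] := dG.
move=> /nbhs_normP[r /= r0 rG]; apply/nbhs_normP; exists r => //= w uw.
have := rG (w - u); rewrite /= sub0r normrN distrC => /(_ uw).
rewrite -(derive_dotprod _ dG) deriveE// !fctE /= subrK opprD addrA.
by [].
Qed.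

(** The difference quotient of [G] along the segment is the one that defines the
    directional derivative. *)
Lemma is_derive_segment G u v (t : R) : differentiable G (u + t *: v) ->
  is_derive t 1 (fun s => G (u + s *: v)) (dotprod (gradient G (u + t *: v)) v).
Proof.
move=> dG.
have quotE : (fun h : R => h^-1 *: (G (u + (h *: 1 + t) *: v) - G (u + t *: v))) =
    (fun h : R => h^-1 *: (G (h *: v + (u + t *: v)) - G (u + t *: v))).
  apply/funext => h; congr (_ *: (G _ - _)).
  by rewrite scalerDl addrCA /GRing.scale/= mulr1.
apply: DeriveDef.
  by rewrite /derivable quotE; exact: diff_derivable.
by rewrite -(derive_dotprod _ dG) /derive quotE.
Qed.

Lemma gradient_mean_value G u v :
  (forall t : R, 0 <= t <= 1 -> differentiable G (u + t *: v)) ->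
  exists2 t : R, 0 <= t <= 1 &
    G (u + v) - G u = dotprod (gradient G (u + t *: v)) v.
Proof.
move=> dG.
pose phi (t : R) := G (u + t *: v).
have [||t t01] := @MVT_segment R phi
    (fun t => dotprod (gradient G (u + t *: v)) v) 0 1 ler01.
- move=> t /subset_itv_oo_cc; rewrite in_itv/= => t01.
  exact: is_derive_segment (dG _ t01).
- apply: derivable_within_continuous => t; rewrite in_itv/= => t01.
  exact: (@ex_derive _ _ _ _ _ _ _ (is_derive_segment (dG _ t01))).
rewrite /phi scale1r scale0r addr0 subr0 mulr1 => ->.
by exists t => //; move: t01; rewrite in_itv.
Qed.

End Gradient.

(** * Operations on pairs of sets *)

Section PairOperations.
Context {R : realType} {H : hilbertType R}.
Implicit Types (A B : set (R^o * H)) (D : @codiff R H) (c alpha : R) (x d : H).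

Lemma set_scalev0 A : A !=set0 -> set_scalev 0 A = [set 0].
Proof.
move=> [a Aa]; apply/seteqP; split=> [_ [b _ <-]|_ ->]; first exact: scale0r.
by exists a => //; exact: scale0r.
Qed.

Lemma set_addv0 A : set_addv A [set 0] = A.
Proof.
apply/seteqP; split=> [_ [a Aa [_ -> <-]]|a Aa]; first by rewrite addr0.
by exists a => //; exists 0 => //; rewrite addr0.
Qed.

Lemma set_add0v A : set_addv [set 0] A = A.
Proof.
apply/seteqP; split=> [_ [_ -> [a Aa <-]]|a Aa]; first by rewrite add0r.
by exists 0 => //; exists a => //; rewrite add0r.
Qed.

(** One of the two multiples is [{0}]. This form has no case distinction on the
    sign of [c], so Hausdorff continuity where the coefficient changes sign
    reduces to that of sums and multiples. *)
Lemma setpair_scale_posneg c D : D.1 !=set0 -> D.2 !=set0 ->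
  setpair_scale c D =
    (set_addv (set_scalev (Num.max c 0) D.1) (set_scalev (Num.min c 0) D.2),
     set_addv (set_scalev (Num.max c 0) D.2) (set_scalev (Num.min c 0) D.1)).
Proof.
move=> D1 D2; rewrite /setpair_scale; case: ifPn => c0.
  by rewrite (max_idPl c0) (min_idPr c0) !set_scalev0// !set_addv0.
have {}c0 : c <= 0 by rewrite ltW// ltNge.
by rewrite (max_idPr c0) (min_idPl c0) !set_scalev0// !set_add0v.
Qed.

Lemma admissible_pair_scale c D :
  admissible_pair D -> admissible_pair (setpair_scale c D).
Proof.
by move=> [a1 a2]; rewrite /setpair_scale; case: ifP => _;
  split; exact: admissible_set_scale.
Qed.

Lemma admissible_pair_sum (I : Type) (r : seq I) (D : I -> @codiff R H) :
  (forall i, admissible_pair (D i)) ->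
  admissible_pair (\big[setpair_add/setpair_zero]_(i <- r) D i).
Proof.
move=> aD; elim/big_ind : _ => [|P Q [P1 P2] [Q1 Q2]|i _]; last exact: aD.
  by split; exact: admissible_set0.
by split; exact: admissible_set_add.
Qed.

Lemma parts_sum (I : Type) (r : seq I) (D : I -> @codiff R H) alpha d :
  (forall i, admissible_pair (D i)) ->
  let S := \big[setpair_add/setpair_zero]_(i <- r) D i in
  upper_part S.1 alpha d = \sum_(i <- r) upper_part (D i).1 alpha d /\
  lower_part S.2 alpha d = \sum_(i <- r) lower_part (D i).2 alpha d.
Proof.
move=> aD; elim: r => [|i r /= [IHu IHl]].
  by rewrite /= !big_nil upper_part0 lower_part0.
have [S1 S2] := admissible_pair_sum r aD; have [Di1 Di2] := aD i.
by rewrite /= !big_cons -IHu -IHl upper_part_add// lower_part_add.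
Qed.

Definition pair_continuous_at (D : H -> @codiff R H) x :=
  hausdorff_continuous_at (fun y => (D y).1) x /\
  hausdorff_continuous_at (fun y => (D y).2) x.

Lemma hausdorff_continuous_near (F F' : H -> set (R^o * H)) x : F x !=set0 ->
  (\forall y \near x, F y = F' y) ->
  hausdorff_continuous_at F x -> hausdorff_continuous_at F' x.
Proof.
move=> Fx0 FF' /(hausdorff_continuousP Fx0) cF.
have FFx := nbhs_singleton FF'.
have F'x0 : F' x !=set0 by rewrite -FFx.
apply/(hausdorff_continuousP F'x0) => e /cF; rewrite -FFx.
by apply: filterS2 FF' => y ->.
Qed.

(** The decomposition of [setpair_scale_posneg] needs nonempty sets, hence holds
    only near [x], which is enough for continuity at [x]. *)
Lemma pair_continuous_scale (c : H -> R) (D : H -> @codiff R H) x :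
  {for x, continuous c} -> (\forall y \near x, admissible_pair (D y)) ->
  pair_continuous_at D x ->
  pair_continuous_at (fun y => setpair_scale (c y) (D y)) x.
Proof.
move=> cc aD [cD1 cD2].
have [[D10 wD1 kD1] [D20 wD2 kD2]] := nbhs_singleton aD.
have [M1 _ DM1] := weakly_compact_bounded wD1.
have [M2 _ DM2] := weakly_compact_bounded wD2.
have cpos : {for x, continuous (fun y => Num.max (c y) 0)}.
  by apply: (@continuous_max _ _ c (fun=> 0)) => //; exact: cvg_cst.
have cneg : {for x, continuous (fun y => Num.min (c y) 0)}.
  by apply: (@continuous_min _ _ c (fun=> 0)) => //; exact: cvg_cst.
have scale0 (l : R) A : A !=set0 -> set_scalev l A !=set0.
  by move=> [a Aa]; exists (l *: a); exists a.
have add0 A B : A !=set0 -> B !=set0 -> set_addv A B !=set0.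
  by move=> [a Aa] [b Bb]; exists (a + b); exists a => //; exists b.
split.
  apply: (@hausdorff_continuous_near (fun y =>
      set_addv (set_scalev (Num.max (c y) 0) (D y).1)
               (set_scalev (Num.min (c y) 0) (D y).2))).
  - exact: add0 (scale0 _ _ D10) (scale0 _ _ D20).
  - by apply: filterS aD => y [[? _ _] [? _ _]]; rewrite setpair_scale_posneg.
  apply: hausdorff_continuous_add; [exact: scale0.. | |].
    exact: hausdorff_continuous_scale DM1 cpos cD1.
  exact: hausdorff_continuous_scale DM2 cneg cD2.
apply: (@hausdorff_continuous_near (fun y =>
    set_addv (set_scalev (Num.max (c y) 0) (D y).2)
             (set_scalev (Num.min (c y) 0) (D y).1))).
- exact: add0 (scale0 _ _ D20) (scale0 _ _ D10).
- by apply: filterS aD => y [[? _ _] [? _ _]]; rewrite setpair_scale_posneg.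
apply: hausdorff_continuous_add; [exact: scale0.. | |].
  exact: hausdorff_continuous_scale DM2 cpos cD2.
exact: hausdorff_continuous_scale DM1 cneg cD1.
Qed.

Lemma pair_continuous_sum (I : Type) (r : seq I) (D : I -> H -> @codiff R H) x :
  (forall i, admissible_pair (D i x)) ->
  (forall i, pair_continuous_at (D i) x) ->
  pair_continuous_at
    (fun y => \big[setpair_add/setpair_zero]_(i <- r) D i y) x.
Proof.
move=> aD cD; elim: r => [|i r [IH1 IH2]].
  have c0 : hausdorff_continuous_at (fun=> [set (0 : R^o * H)]) x.
    apply/hausdorff_continuousP => [|e e0]; first by exists 0.
    by apply: nearW => _; split=> a ->; exists 0; rewrite // subrr normr0 ltW.
  by split; under eq_fun do rewrite big_nil.
have [S1 S2] := admissible_pair_sum r aD.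
have [[D1 _ _] [D2 _ _]] := aD i; have [cD1 cD2] := cD i.
by split; under eq_fun do rewrite big_cons; apply: hausdorff_continuous_add => //;
  [case: S1 | case: S2].
Qed.

End PairOperations.

(** * The chain rule *)

Section ChainRule.
Context {R : realType} {H : hilbertType R} {m : nat}.
Implicit Types (f : 'I_m -> H -> R) (G : 'rV[R]_m -> R) (D : 'I_m -> @codiff R H).

Definition chain_codiff (c : 'I_m -> R) D : @codiff R H :=
  \big[setpair_add/setpair_zero]_(i < m) setpair_scale (c i) (D i).

(** A negative coefficient exchanges the two sets of a pair and also exchanges
    suprema with infima, so only the sum of the two parts is linear in [c i]. *)
Lemma chain_parts (c : 'I_m -> R) D (alpha : R) (d : H) :
  (forall i, admissible_pair (D i)) ->
  upper_part (chain_codiff c D).1 alpha d +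
    lower_part (chain_codiff c D).2 alpha d =
  \sum_(i < m) c i * (upper_part (D i).1 alpha d + lower_part (D i).2 alpha d).
Proof.
move=> aD.
have [-> ->] := parts_sum (index_enum 'I_m) alpha d
  (fun i => admissible_pair_scale (c i) (aD i)).
rewrite -big_split; apply: eq_bigr => i _ /=.
have [-> ->] := setpair_scale_parts (c i) alpha d (aD i).
by case: ifP => _; rewrite mulrDr// addrC.
Qed.

Lemma chain_normalized (c : 'I_m -> R) D :
  (forall i, admissible_pair (D i)) -> (forall i, normalized (D i)) ->
  normalized (chain_codiff c D).
Proof.
move=> aD nD; rewrite /normalized.
rewrite -(upper_part_alpha0 _ (0 : H)) -(lower_part_alpha0 _ (0 : H)).
have [-> ->] := parts_sum (index_enum 'I_m) 0 (0 : H)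
  (fun i => admissible_pair_scale (c i) (aD i)).
split; apply: big1 => i _;
  have [U L] := setpair_scale_parts (c i) 0 (0 : H) (aD i);
  rewrite ?U ?L upper_part_alpha0 lower_part_alpha0 (nD i).1 (nD i).2;
  by rewrite mulr0 if_same.
Qed.

(** The extrema of the chain rule pair cancel the [c i]-combination of those of the
    [f i], leaving the first-order error of [G] and the remainders. *)
Lemma chain_remainder f G D (alpha : R) (d x : H) :
  (forall i, admissible_pair (D i)) ->
  let F := tuple_fun f in let F' := F (x + alpha *: d) in
  codiff_remainder (fun z => G (F z))
    (chain_codiff (fun i => partial_derivative G i (F x)) D) alpha d x =
  G F' - G (F x) - dotprod (gradient G (F x)) (F' - F x) +
  \sum_(i < m) partial_derivative G i (F x) *
    codiff_remainder (f i) (D i) alpha d x.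
Proof.
move=> aD F F'; rewrite /codiff_remainder -addrA -opprD chain_parts//.
rewrite -[RHS]addrA; congr (_ + _).
rewrite /dotprod -!sumrN -big_split; apply: eq_bigr => i _ /=.
by rewrite !mxE; ring.
Qed.

Lemma tuple_fun_continuous f (x : H) :
  (forall i, {for x, continuous (f i)}) -> {for x, continuous (tuple_fun f)}.
Proof.
move=> cf; apply/cvgrPdist_le => e e0.
have : \forall y \near x, forall i, `|f i x - f i y| <= e.
  by apply: filter_forall => i; exact: (cvgr_dist_le _ _ (cf i)).
apply: filterS => y fxy; apply: row_norm_le; first exact: ltW.
by move=> i; rewrite !mxE.
Qed.

(** The increment of [F] along the ray is at most [K * alpha], so the first-order
    error of [G] is [o(alpha)]; the remainders of the [f i] are by hypothesis. *)
Lemma chain_is_codifferential f G D (x : H) :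
  differentiable G (tuple_fun f x) ->
  (forall i, is_codifferential (f i) x (D i)) ->
  (forall i, normalized (D i)) ->
  is_codifferential (fun z => G (tuple_fun f z)) x
    (chain_codiff (fun i => partial_derivative G i (tuple_fun f x)) D).
Proof.
move=> dG cD nD; pose F := tuple_fun f.
pose c i := partial_derivative G i (F x).
have aD i : admissible_pair (D i) by have [? ? _ _] := cD i.
have [S1 S2] : admissible_pair (chain_codiff c D).
  by apply: admissible_pair_sum => i; exact: admissible_pair_scale.
have [N1 N2] := chain_normalized c aD nD.
split=> //; last by rewrite N1 N2 addr0.
move=> d.
have [K K0 incr] : exists2 K : R, 0 < K & \forall alpha \near 0^'+,
    `|F (x + alpha *: d) - F x| <= K * alpha.
  have boundD i : exists k : R, 0 <= k /\ \forall alpha \near 0^'+,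
      `|f i (x + alpha *: d) - f i x| <= k * alpha.
    have [[_ w1 _] [_ w2 _]] := aD i.
    have [M1 M10 DM1] := weakly_compact_bounded w1.
    have [M2 M20 DM2] := weakly_compact_bounded w2.
    exists (2 * (Num.max M1 M2 * `|d|) + 1); split.
      by rewrite addr_ge0// !mulr_ge0// le_max M10.
    apply: codifferential_increment_le (cD i) (nD i) _ _ ltr01 => p Dp.
      by rewrite le_max DM1.
    by rewrite le_max DM2// orbT.
  have [k kP] := choice boundD.
  have k0 i : 0 <= k i by have [] := kP i.
  exists (1 + \sum_(i < m) k i); first by rewrite ltr_pwDl// sumr_ge0.
  near=> alpha.
  have a0 : 0 < alpha by near: alpha; exact: nbhs_right_gt.
  apply: row_norm_le => [|i].
    by rewrite mulr_ge0 ?(ltW a0)// addr_ge0// sumr_ge0.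
  rewrite !mxE (@le_trans _ _ (k i * alpha))//.
    by move: i; near: alpha; apply: filter_forall => i; have [] := kP i.
  rewrite ler_wpM2r ?(ltW a0)// (bigD1 i)//= addrCA lerDl.
  by rewrite addr_ge0// sumr_ge0.
apply/cvgr0Pnorm_le => e e0.
pose C := \sum_(i < m) `|c i|.
have C0 : 0 <= C by rewrite sumr_ge0.
(* The two error terms receive half of [e * alpha] each; [C + 1] avoids dividing
   by zero when all coefficients vanish. *)
have e1 : 0 < e / 2 / K by rewrite !divr_gt0.
have e2 : 0 < e / 2 / (C + 1) by rewrite !divr_gt0// ltr_wpDl.
have /nbhs_normP[rho /= rho0 Gx] := gradient_remainder_le dG e1.
near=> alpha.
have a0 : 0 < alpha by near: alpha; exact: nbhs_right_gt.
have dF : `|F (x + alpha *: d) - F x| <= K * alpha by near: alpha; exact: incr.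
have arho : alpha < rho / K.
  by near: alpha; apply: nbhs_right_lt; rewrite divr_gt0.
have remi i : `|codiff_remainder (f i) (D i) alpha d x| <=
    e / 2 / (C + 1) * alpha.
  have : `|alpha^-1 * `|codiff_remainder (f i) (D i) alpha d x| | <=
      e / 2 / (C + 1).
    move: i; near: alpha; apply: filter_forall => i.
    by have [_ _ /(_ d) lim0 _] := cD i; exact: (cvgr0_norm_le _ lim0).
  rewrite normrM normr_id gtr0_norm ?invr_gt0// ler_pdivrMl//.
  by rewrite [alpha * _]mulrC.
rewrite normrM normr_id gtr0_norm ?invr_gt0// ler_pdivrMl//.
rewrite chain_remainder// (le_trans (ler_normD _ _))//.
rewrite [in leRHS](splitr e) mulrDr lerD//.
  rewrite (le_trans (Gx _ _))//=.
    rewrite distrC (le_lt_trans dF)// mulrC -ltr_pdivlMr//.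
  rewrite (le_trans (ler_wpM2l (ltW e1) dF))//.
  by rewrite [leLHS]mulrA divfK ?gt_eqF// mulrC.
rewrite (le_trans (ler_norm_sum _ _ _))//.
rewrite (@le_trans _ _ (\sum_(i < m) `|c i| * (e / 2 / (C + 1) * alpha)))//.
  by apply: ler_sum => i _; rewrite normrM ler_wpM2l.
rewrite -mulr_suml -/C [leRHS]mulrC mulrA ler_pM2r//.
rewrite mulrCA ler_piMr ?divr_ge0 ?(ltW e0)//.
by rewrite ler_pdivrMr ?mul1r ?lerDl// ltr_wpDl.
Unshelve. all: by end_near. Qed.

(** The supremum is that of a bounded set, because the gradient is continuous
    along the compact segment; it therefore dominates the value at the mean value
    point. *)
Lemma chain_error_le f G D (V : set 'rV[R]_m) (x d : H) (alpha : R) :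
  let F := tuple_fun f in
  let y := fun t : R => t *: F x + (1 - t) *: F (x + alpha *: d) in
  (forall i, admissible_pair (D i)) -> continuously_differentiable V G ->
  (forall t, 0 <= t <= 1 -> V (y t)) -> 0 < alpha ->
  `|codiff_error (fun z => G (F z))
      (chain_codiff (fun i => partial_derivative G i (F x)) D) alpha d x| <=
    \sum_(i < m) `|partial_derivative G i (F x)|
                 * `|codiff_error (f i) (D i) alpha d x|
    + alpha^-1 * sup [set `|dotprod (gradient G (y t) - gradient G (F x))
                                    (F (x + alpha *: d) - F x)|
                     | t in `[0, 1]].
Proof.
move=> F y aD cG Vy a0; set F' := F (x + alpha *: d).
set S := [set _ | _ in _].
have yE t : y t = F' + t *: (F x - F').
  by rewrite /y -/F' scalerBl scale1r scalerBr addrCA addrA.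
have supS : has_sup S.
  apply: compact_has_sup.
    by eexists; exists 0; [rewrite /= in_itv/= lexx ler01 | reflexivity].
  apply: continuous_compact; last exact: segment_compact.
  apply: continuous_in_subspaceT => t; rewrite inE/= in_itv/= => t01.
  apply: cvg_norm; rewrite /dotprod; apply: cvg_big; first exact: add_continuous.
  move=> i _; apply: cvgM; last exact: cvg_cst.
  have cy : {for t, continuous y}.
    apply: cvgD; apply: cvgZ; [exact: cvg_id | exact: cvg_cst | |
      exact: cvg_cst].
    by apply: cvgB; [exact: cvg_cst | exact: cvg_id].
  have cgrad : {for t, continuous (gradient G \o y)}.
    by apply: (continuous_comp cy); have [] := cG _ (Vy _ t01).
  have cdiff : {for t, continuous (fun s => gradient G (y s) - gradient G (F x))}.
    by apply: cvgB; [exact: cgrad | exact: cvg_cst].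
  apply: (@continuous_comp _ _ _ _ (fun M : 'rV[R]_m => M 0 i) _ cdiff).
  exact: coord_continuous.
have [t t01 GE] : exists2 t : R, 0 <= t <= 1 &
    G F' - G (F x) = dotprod (gradient G (y t)) (F' - F x).
  have [t t01|t t01] := @gradient_mean_value R m G F' (F x - F').
    by rewrite -yE; have [] := cG _ (Vy _ t01).
  rewrite -yE [F' + _]addrC subrK => GE; exists t => //.
  by rewrite -(opprB (F x)) dotprodNr -GE opprB.
rewrite /codiff_error chain_remainder// -/F -/F' GE.
rewrite -dotprodNl -dotprodDl mulrDr (le_trans (ler_normD _ _))// addrC lerD//.
  rewrite mulr_sumr (le_trans (ler_norm_sum _ _ _))//.
  by apply: ler_sum => i _; rewrite mulrCA normrM.
rewrite normrM gtr0_norm ?invr_gt0// ler_pM2l ?invr_gt0//.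
by apply: ub_le_sup supS.2 _ _; exists t.
Qed.

End ChainRule.

Theorem theorem2 (R : realType) (H : hilbertType R) (U : set H) (m : nat)
    (f : 'I_m -> H -> R) (V : set 'rV[R]_m) (G : 'rV[R]_m -> R) :
  open U ->
  (forall i, continuously_codifferentiable U (f i)) ->
  open V ->
  tuple_fun f @` U `<=` V ->
  continuously_differentiable V G ->
  let F := tuple_fun f in
  let g := fun x : H => G (F x) in
  continuously_codifferentiable U g /\
  forall Df : 'I_m -> H -> codiff,
    (forall i, continuous_codifferential U (f i) (Df i)) ->
    let Dg := fun x : H => \big[setpair_add/setpair_zero]_(i < m)
                 setpair_scale (partial_derivative G i (F x)) (Df i x) in
    continuous_codifferential U g Dg /\
    forall (x : H) (r : R), U x -> 0 < r -> cball x r `<=` U ->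
      convex_hull (F @` cball x r) `<=` V ->
      forall (dx : H) (alpha : R), cball 0 r dx -> 0 < alpha -> alpha <= 1 ->
        let y := fun t : R => t *: F x + (1 - t) *: F (x + alpha *: dx) in
        `|codiff_error g (Dg x) alpha dx x| <=
          \sum_(i < m) `|partial_derivative G i (F x)|
                       * `|codiff_error (f i) (Df i x) alpha dx x|
          + alpha^-1 * sup [set `|dotprod (gradient G (y t) - gradient G (F x))
                                          (F (x + alpha *: dx) - F x)|
                           | t in `[0, 1]].
Proof.
move=> oU cdf oV FUV cG F g.
have chain (Df : 'I_m -> H -> codiff) :
    (forall i, continuous_codifferential U (f i) (Df i)) ->
    continuous_codifferential U g (fun x =>
      chain_codiff (fun i => partial_derivative G i (F x)) (Df ^~ x)).
  move=> cDf x Ux.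
  have VF : V (F x) by apply: FUV; exists x.
  have [dG cgrad] := cG _ VF.
  have aD y i : U y -> admissible_pair (Df i y).
    by move=> Uy; have [[? ? _ _] _ _ _] := cDf i _ Uy.
  have cF : {for x, continuous F}.
    apply: tuple_fun_continuous => i.
    exact: continuous_codifferential_continuous oU (cDf i) Ux.
  have [c1 c2] : pair_continuous_at (fun x =>
      chain_codiff (fun i => partial_derivative G i (F x)) (Df ^~ x)) x.
    apply: (@pair_continuous_sum R H _ _ (fun i y =>
        setpair_scale (partial_derivative G i (F y)) (Df i y))) => i.
      exact/admissible_pair_scale/aD.
    apply: pair_continuous_scale.
    - rewrite (_ : (fun y => _) = (fun M : 'rV[R]_m => M 0 i) \o (gradient G \o F)).
        apply: continuous_comp; last exact: coord_continuous.
        exact: continuous_comp.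
      by apply/funext => y /=; rewrite mxE.
    - by apply: filterS (open_nbhs_nbhs (conj oU Ux)) => y; exact: aD.
    - by have [_ _ ? ?] := cDf i _ Ux.
  split=> //.
    apply: chain_is_codifferential => // i; by have [] := cDf i _ Ux.
  by apply: chain_normalized => i; [exact: aD | have [] := cDf i _ Ux].
split.
  have [Df cDf] := choice cdf.
  by eexists; exact: (chain Df).
move=> Df cDf Dg; split; first exact: chain.
move=> x r Ux r0 xrU hullV dx alpha dxr a0 a1.
apply: (@chain_error_le R H m f G (Df ^~ x) V) => // [i|t /andP[t0 t1]].
  by have [[? ? _ _] _ _ _] := cDf i _ Ux.
apply: hullV => C [cC FC].
have Cx : C (F x) by apply: FC; exists x => //; rewrite /cball/= subrr normr0 ltW.
have Cx' : C (F (x + alpha *: dx)).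
  apply: FC; eexists; last reflexivity.
  rewrite /cball/= addrC addKr normrZ gtr0_norm//.
  have := dxr; rewrite /cball/= subr0 => dr.
  by rewrite (le_trans _ dr)// ler_piMl.
have := cC (F x) (F (x + alpha *: dx)) (Itv01 t0 t1).
by rewrite !inE => /(_ Cx Cx').
Qed.
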